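(* If $\kappa\ge\|f'\|_{C[-\beta,\beta]}$, then the GSAV-EI1 scheme preserves the maximum bound principle unconditionally: for every time step size $\tau>0$, if $\|u_{\rm init}\|_\infty\le\beta$, then $\|u^n\|_\infty\le\beta$ for all $n\ge0$.
   Context: Spatial setting. Let $L>0$, $\Omega=(0,L)\times(0,L)$, $|\Omega|=L^2$, $M$ a positive integer, $h=L/M$. Let $\mathcal{M}_h$ be the finite-dimensional space of real grid functions $v=(v_{ij})_{i,j\in\mathbb{Z}}$ that are $M$-periodic in each index. For $v,w\in\mathcal{M}_h$ set $\langle v,w\rangle=h^2\sum_{i,j=1}^M v_{ij}w_{ij}$, $\|v\|=\sqrt{\langle v,v\rangle}$, $\|v\|_\infty=\max_{1\le i,j\le M}|v_{ij}|$. The discrete Laplacian is $\Delta_h v_{ij}=h^{-2}(v_{i+1,j}+v_{i-1,j}+v_{i,j+1}+v_{i,j-1}-4v_{ij})$. Scalar functions act on grid functions pointwise; functions of self-adjoint linear operators on $\mathcal{M}_h$ are understood as matrix functions; $I$ is the identity. Standing assumptions. $\varepsilon>0$; $f:\mathbb{R}\to\mathbb{R}$ is continuously differentiable and there is a constant $\beta>0$ (fixed) with $f(\beta)\le 0\le f(-\beta)$; $\|f'\|_{C[-\beta,\beta]}=\max_{[-\beta,\beta]}|f'|$; $F$ is a function with $F'=-f$; $u_{\rm init}\in\mathcal{M}_h$ is the (grid-projected) initial value; $\kappa>0$ is a stabilizing constant; $\sigma:\mathbb{R}\to\mathbb{R}$ is continuously differentiable with $\sigma>0$ and $\sigma'\ge0$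 on $\mathbb{R}$. Notation. $E_{1h}(v)=\langle F(v),1\rangle$ and $g(v,r)=\sigma(r)/\sigma(E_{1h}(v))$ for $v\in\mathcal{M}_h$, $r\in\mathbb{R}$. GSAV-EI1 scheme with step $\tau>0$. $u^0=u_{\rm init}$, $s^0=E_{1h}(u^0)$, and for $n\ge0$, with $L_\kappa^n=\kappa g(u^n,s^n)I-\varepsilon^2\Delta_h$, $N_\kappa^n(v,r)=g(v,r)f(v)+\kappa g(u^n,s^n)v$, and $\phi_1(a)=a^{-1}(e^a-1)$ for $a\ne0$, $$u^{n+1}=e^{-\tau L_\kappa^n}u^n+\tau\phi_1(-\tau L_\kappa^n)N_\kappa^n(u^n,s^n),\qquad s^{n+1}=s^n-g(u^n,s^n)\langle f(u^n),u^{n+1}-u^n\rangle.$$ *)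

(* Defs.v *)
From HB Require Import structures.
From mathcomp Require Import all_boot all_order all_algebra.
From mathcomp Require Import all_classical all_reals all_analysis.

Set Implicit Arguments.
Unset Strict Implicit.
Unset Printing Implicit Defensive.

Import Order.TTheory GRing.Theory Num.Theory.
Import numFieldNormedType.Exports.

Local Open Scope classical_set_scope.
Local Open Scope ring_scope.

(* An M-periodic grid function on Z^2 is given by its values on (Z/MZ)^2, that
   is, by a matrix in 'M[R]_M; ordS and ord_pred are the successor and the
   predecessor modulo M.  The library norm `|v| on 'M[R]_M is the max norm
   (mx_normrE). *)

Definition mesh (R : realType) (L : R) (M : nat) : R := L / M%:R.

Definition grid_dot (R : realType) (L : R) (M : nat) (v w : 'M[R]_M) : R :=
  mesh L M ^+ 2 * \sum_i \sum_j v i j * w i j.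

Definition laplacian (R : realType) (L : R) (M : nat) (v : 'M[R]_M) : 'M[R]_M :=
  \matrix_(i, j) ((mesh L M ^+ 2)^-1 *
    (v (ordS i) j + v (ord_pred i) j + v i (ordS j) + v i (ord_pred j)
     - 4 * v i j)).

(* The matrix function phi(A) = P^-1 diag(phi(d_k)) P for a diagonalization
   A = P^-1 diag(d_k) P over R (which exists when A is symmetric); its value
   does not depend on the diagonalization.  When A has none, it is an
   unspecified matrix. *)
Definition mxfun (R : realType) (phi : R -> R) (n : nat) (A : 'M[R]_n) :
    'M[R]_n :=
  let Pd := xget (1%:M, 0)
    [set Pd : 'M[R]_n * 'rV[R]_n |
      Pd.1 \in unitmx /\ A = invmx Pd.1 *m diag_mx Pd.2 *m Pd.1] in
  invmx Pd.1 *m diag_mx (map_mx phi Pd.2) *m Pd.1.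

(* phi(A) for a linear operator A on grid functions, computed on the matrix of
   A in the standard basis; mxvec and lin_mx use row vectors, acted on from the
   right. *)
Definition opfun (R : realType) (M : nat) (phi : R -> R)
    (A : 'M[R]_M -> 'M[R]_M) (v : 'M[R]_M) : 'M[R]_M :=
  vec_mx (mxvec v *m mxfun phi (lin_mx A)).

Definition phi1 (R : realType) (a : R) : R := a^-1 * (expR a - 1).

Definition energy1 (R : realType) (L : R) (M : nat) (F : R -> R)
    (v : 'M[R]_M) : R :=
  grid_dot L (map_mx F v) (const_mx 1).

Definition gratio (R : realType) (L : R) (M : nat) (F sigma : R -> R)
    (v : 'M[R]_M) (r : R) : R :=
  sigma r / sigma (energy1 L F v).

(* L_kappa^n and N_kappa^n(v, r), with g(u^n, s^n) passed as gn. *)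
Definition Lkappa (R : realType) (L : R) (M : nat) (eps kappa gn : R)
    (v : 'M[R]_M) : 'M[R]_M :=
  (kappa * gn) *: v - eps ^+ 2 *: laplacian L v.

Definition Nkappa (R : realType) (L : R) (M : nat) (f F sigma : R -> R)
    (kappa gn : R) (v : 'M[R]_M) (r : R) : 'M[R]_M :=
  gratio L F sigma v r *: map_mx f v + (kappa * gn) *: v.

Definition gsav_ei1_step (R : realType) (L : R) (M : nat) (eps : R)
    (f F sigma : R -> R) (kappa tau : R) (us : 'M[R]_M * R) : 'M[R]_M * R :=
  let u := us.1 in
  let s := us.2 in
  let gn := gratio L F sigma u s in
  let A := fun v : 'M[R]_M => - tau *: Lkappa L eps kappa gn v in
  let u' := opfun (@expR R) A u +
            tau *: opfun (@phi1 R) A (Nkappa L f F sigma kappa gn u s) in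
  (u', s - gn * grid_dot L (map_mx f u) (u' - u)).

(* The pair (u^n, s^n). *)
Definition gsav_ei1 (R : realType) (L : R) (M : nat) (eps : R)
    (f F sigma : R -> R) (kappa tau : R) (u_init : 'M[R]_M) (n : nat) :
    'M[R]_M * R :=
  iter n (gsav_ei1_step L eps f F sigma kappa tau)
    (u_init, energy1 L F u_init).

Definition continuously_differentiable (R : realType) (f : R -> R) : Prop :=
  (forall x : R, derivable f x 1) /\ continuous (f^`())%classic.

Definition sup_norm_on (R : realType) (a b : R) (f : R -> R) : R :=
  sup [set `|f x| | x in `[a, b]].

(* Main.v *)
(* The step is the time-tau flow of the linear equation y' = - L_kappa y + N
   from y = u^n, with N frozen.  Forward Euler with a small step h preserves
   the ball of radius beta: I - h L_kappa is entrywise nonnegative with row sums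
   1 - h kappa g, while |N| <= kappa g beta because f + kappa id is nondecreasing
   on [-beta, beta] and maps it into [-kappa beta, kappa beta].  In an
   eigenbasis, (1 + d/n)^n -> e^d shows that the Euler iterates converge to the
   flow.  A real eigenbasis exists because the discrete Laplacian is symmetric;
   no eigenvalue vanishes (so the junk value of phi1 at 0 is harmless) because
   I - h L_kappa is a strict contraction. *)
Require Import Defs.
From HB Require Import structures.
From mathcomp Require Import all_boot all_order all_algebra.
From mathcomp Require Import all_classical all_reals all_analysis.
From mathcomp Require Import ring lra.
From mathcomp Require Import complex.

Set Implicit Arguments.
Unset Strict Implicit.
Unset Printing Implicit Defensive.

Import Order.TTheory GRing.Theory Num.Theory.
Import numFieldNormedType.Exports.

Local Open Scope classical_set_scope.
Local Open Scope ring_scope.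

(** * Real diagonalization of symmetric matrices *)

(* Over R[i] the spectral theorem gives A ~ diag(d) with d real, and real
   matrices that are similar over R[i] are similar over R. *)
Lemma symmetric_diagonalization (R : rcfType) (n : nat) (A : 'M[R]_n) :
  A^T = A ->
  exists Pd : 'M[R]_n * 'rV[R]_n,
    Pd.1 \in unitmx /\ A = invmx Pd.1 *m diag_mx Pd.2 *m Pd.1.
Proof.
move=> symA.
pose toC := complex.real_complex R.
pose A' := map_mx toC A.
have toCr m p (B : 'M[R]_(m, p)) : map_mx toC B \is a mxOver Num.real.
  by apply/mxOverP => i j; rewrite mxE; apply/complex.complex_realP; exists (B i j).
have hA : A' \is hermsymmx.
  apply: realsym_hermsym; last exact: toCr.
  apply/is_hermitianmxP; rewrite expr0 scale1r.
  by apply/matrixP => i j; rewrite !mxE -[A in LHS]symA mxE.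
have dr := hermitian_spectral_diag_real hA.
have /orthomx_spectralP eqA := hermitian_normalmx hA.
set P := spectralmx A' in eqA.
set d := spectral_diag A' in dr eqA.
have Pu : P \in unitmx by exact: spectral_unit.
have : exists2 Q, Q \in unitmx & mxred.similar Q A' (diag_mx d).
  exists P => //; apply/mxred.similarP => //.
  by rewrite {1}eqA !mulmxA mulmxV// mul1mx.
have realK m p (B : 'M[complex.complex R]_(m, p)) : B \is a mxOver Num.real ->
    map_mx toC (map_mx (@complex.Re R) B) = B.
  move=> /mxOverP Br; apply/matrixP => i j; rewrite !mxE.
  by rewrite /toC complex.RRe_real.
have drd : diag_mx d \is a mxOver Num.real.
  apply/mxOverP => i j; rewrite !mxE; case: eqP => _; rewrite ?mulr1n ?mulr0n//.
  exact: (mxOverP dr).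
move=> /real_similar -/(_ (toCr _ _ _) drd)[Q].
rewrite inE => /andP[Qr Qu] /(mxred.similarP Qu) QA.
pose Q0 := map_mx (@complex.Re R) Q; pose d0 := map_mx (@complex.Re R) d.
have Q0u : Q0 \in unitmx by rewrite -(map_unitmx toC) realK.
exists (Q0, d0); split=> //=.
suff QA0 : Q0 *m A = diag_mx d0 *m Q0 by rewrite -mulmxA -QA0 mulKmx.
apply: (map_mx_inj (f := toC)).
by rewrite !map_mxM map_diag_mx !realK.
Qed.

(** * The max norm and the exponential limit *)

Lemma mx_norm_leP (R : realType) (m n : nat) (A : 'M[R]_(m, n)) (b : R) :
  0 <= b -> (forall i j, `|A i j| <= b) <-> `|A| <= b.
Proof.
move=> b0; rewrite /Num.Def.normr /= mx_normrE; split=> [Ab|/bigmax_leP[_ Ab] i j].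
  by apply/bigmax_leP; split=> // -[i j] _; exact: Ab.
exact: (Ab (i, j)).
Qed.

Lemma mx_norm_entry (R : realType) (m n : nat) (A : 'M[R]_(m, n)) i j :
  `|A i j| <= `|A|.
Proof. exact: (mx_norm_leP A (normr_ge0 A)).2. Qed.

Lemma mxvec_norm (R : realType) (m n : nat) (A : 'M[R]_(m, n)) :
  `|mxvec A| = `|A|.
Proof.
apply/eqP; rewrite eq_le; apply/andP; split; apply/mx_norm_leP => // i j.
  by rewrite ord1; case/mxvec_indexP: j => k l; rewrite mxvecE mx_norm_entry.
by rewrite -mxvecE mx_norm_entry.
Qed.

(** The logarithm of the sequence is the difference quotient at 0 of [ln (1 + x * d)] along
    [x = 1/(n+1)], so it tends to the derivative [d]; continuity of [expR] concludes. *)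
Lemma cvg_expR_compound (R : realType) (d : R) :
  (1 + n.+1%:R^-1 * d) ^+ n.+1 @[n --> \oo] --> expR d.
Proof.
pose g : R -> R := fun x => ln (1 + x * d).
have dg : is_derive (0 : R) (1 : R) g d.
  have dl : is_derive (1 + 0 * d : R) (1 : R) (@ln R) 1.
    by apply: is_derive_eq (is_derive1_ln _) _; rewrite mul0r addr0 ?invr1 ?ltr01.
  have dh : is_derive (0 : R) (1 : R) (fun x : R => 1 + x * d) d.
    have := is_deriveD (is_derive_cst (1 : R) (0 : R) (1 : R))
      (is_deriveZ d (is_derive_id (0 : R) (1 : R))).
    rewrite add0r [d *: _]mulr1; congr (is_derive _ _ _ _).
    by apply/funext => x; rewrite /= mulrC.
  have := @is_derive1_comp _ (@ln R) (fun x : R => 1 + x * d) 0 1 d dl dh.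
  by rewrite mul1r.
have [dgE dgv] := dg.
have lg : n.+1%:R * ln (1 + n.+1%:R^-1 * d) @[n --> \oo] --> d.
  have : h^-1 *: ((g \o shift 0) (h *: 1) - g 0) @[h --> (0 : R)^'] --> d.
    by rewrite -dgv; exact: dgE.
  have hn0 n : harmonic n != 0 :> R by rewrite /harmonic/= invr_eq0 pnatr_eq0.
  move=> /cvgr_dnbhsP /(_ _ (conj hn0 (@cvg_harmonic R))).
  apply: cvg_trans; apply: near_eq_cvg; apply: nearW => n.
  by rewrite /g /= /GRing.scale/= invrK mulr1 addr0 mul0r addr0 ln1 subr0.
(* For negative [d] the base may fail to be positive at small [n], so [lnK] applies only
   eventually. *)
have pos : \forall n \near \oo, 0 < 1 + n.+1%:R^-1 * d.
  have : 1 + harmonic n * d @[n --> \oo] --> (1 + 0 * d : R).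
    by apply: cvgD; [exact: cvg_cst|apply: cvgMl; exact: cvg_harmonic].
  by rewrite mul0r addr0 => /cvgr_gt; exact.
have := cvg_comp _ _ lg (@continuous_expR R d).
apply: cvg_trans; apply: near_eq_cvg; near=> n.
by rewrite /= expRM_natl lnK// posrE; near: n; exact: pos.
Unshelve. all: by end_near.
Qed.

(** * Functions of a symmetric matrix *)

Definition spec_mx (R : realType) (n : nat) (P : 'M[R]_n) (d : 'rV[R]_n)
    (phi : R -> R) : 'M[R]_n :=
  invmx P *m diag_mx (map_mx phi d) *m P.

(** The pair picked by [xget] does not depend on [phi], so a single eigenbasis serves the identity,
    [expR] and [phi1] at once. *)
Lemma mxfun_spec (R : realType) (n : nat) (A : 'M[R]_n) : A^T = A ->
  exists P d, [/\ P \in unitmx, A = spec_mx P d id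
    & forall phi, mxfun phi A = spec_mx P d phi].
Proof.
move=> /symmetric_diagonalization /(xgetPex (1%:M, 0)).
set Pd := xget _ _; move=> [Pu eqA]; exists Pd.1, Pd.2; split => //.
by rewrite /spec_mx map_mx_id.
Qed.

Lemma mul_spec_mx (R : realType) (n : nat) (P : 'M[R]_n) (d : 'rV[R]_n)
    (phi : R -> R) (v : 'rV[R]_n) j :
  (v *m spec_mx P d phi) 0 j =
  \sum_k (v *m invmx P) 0 k * phi (d 0 k) * P k j.
Proof.
rewrite /spec_mx !mulmxA mxE; apply: eq_bigr => k _.
by rewrite mul_mx_diag !mxE.
Qed.

Lemma spec_mxM (R : realType) (n : nat) (P : 'M[R]_n) (d : 'rV[R]_n)
    (phi psi : R -> R) : P \in unitmx ->
  spec_mx P d phi *m spec_mx P d psi = spec_mx P d (phi \* psi).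
Proof.
move=> Pu; rewrite /spec_mx -!mulmxA mulKVmx// !mulmxA; congr (_ *m _).
rewrite -!mulmxA mulmx_diag; congr (_ *m diag_mx _).
by apply/rowP => k; rewrite !mxE.
Qed.

Lemma spec_mx1 (R : realType) (n : nat) (P : 'M[R]_n) (d : 'rV[R]_n) :
  P \in unitmx -> spec_mx P d (cst 1) = 1%:M.
Proof.
move=> Pu; rewrite /spec_mx (_ : map_mx _ _ = const_mx 1).
  by rewrite diag_const_mx mulmx1 mulVmx.
by apply/rowP => k; rewrite !mxE.
Qed.

Lemma cvg_mul_spec_mx (R : realType) (n : nat) (P : 'M[R]_n) (d : 'rV[R]_n)
    (phi : nat -> R -> R) (psi : R -> R) (v : 'rV[R]_n) j :
  (forall k, phi m (d 0 k) @[m --> \oo] --> psi (d 0 k)) ->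
  (v *m spec_mx P d (phi m)) 0 j @[m --> \oo] --> (v *m spec_mx P d psi) 0 j.
Proof.
move=> cv; rewrite mul_spec_mx.
under eq_fun do rewrite mul_spec_mx.
apply: cvg_big => [|k _]; first exact: add_continuous.
by apply: cvgMl; apply: cvgMr; exact: cv.
Qed.

(** * Forward Euler iterates and their limit *)

(* The k-th forward Euler iterate of y' = y B + w from y(0) = u with step h. *)
Definition euler (R : realType) (n : nat) (B : 'M[R]_n) (h : R)
    (u w : 'rV[R]_n) (k : nat) : 'rV[R]_n :=
  iter k (fun y => y + h *: (y *m B + w)) u.

(** On an eigenvector with eigenvalue [x], the source contributes the geometric sum of
    [h * (1 + h * x) ^+ j] over [j < k]. At [k * h = 1] the two factors tend to [expR x] and
    [phi1 x]. *)
Lemma euler_spec (R : realType) (n : nat) (P : 'M[R]_n) (d : 'rV[R]_n)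
    (h : R) (u w : 'rV[R]_n) (k : nat) :
  P \in unitmx -> (forall i, d 0 i != 0) ->
  euler (spec_mx P d id) h u w k =
  u *m spec_mx P d (fun x => (1 + h * x) ^+ k) +
  w *m spec_mx P d (fun x => x^-1 * ((1 + h * x) ^+ k - 1)).
Proof.
move=> Pu dn0; elim: k => [|k]; last rewrite /euler iterS => ->.
  rewrite /euler/= (_ : (fun x => _) = cst 1) ?spec_mx1// mulmx1.
  rewrite (_ : spec_mx _ _ _ = 0) ?mulmx0 ?addr0//.
  rewrite /spec_mx (_ : map_mx _ _ = 0) ?raddf0 ?mulmx0 ?mul0mx//.
  by apply/rowP => i; rewrite !mxE expr0 subrr mulr0.
rewrite mulmxDl -(mulmxA u) -(mulmxA w) !spec_mxM//; apply/rowP => j.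
(* Expands the bare [w] in the eigenbasis, so that both sides compare mode by mode. *)
have := mul_spec_mx P d (cst 1) w j; rewrite spec_mx1// mulmx1 => wj.
rewrite !(mul_spec_mx, mxE) wj !mulrDr !mulr_sumr -!big_split/=.
apply: eq_bigr => i _; have := dn0 i; set c := d 0 i => c0.
by rewrite !exprS; field.
Qed.

(** The radius [b] is reproduced at each step: [(1 - h * a) * b + h * (a * b) = b]. *)
Lemma euler_norm_le (R : realType) (n : nat) (B : 'M[R]_n) (h a b : R)
    (u w : 'rV[R]_n) (k : nat) :
  0 <= h -> h * a <= 1 ->
  (forall v : 'rV[R]_n, `|v + h *: (v *m B)| <= (1 - h * a) * `|v|) ->
  `|u| <= b -> `|w| <= a * b -> `|euler B h u w k| <= b.
Proof.
move=> h0 ha cB ub wb; elim: k => [//|k IH].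
rewrite /euler iterS -/(euler _ _ _ _ _).
set y := euler _ _ _ _ _ in IH *.
rewrite scalerDr addrA (le_trans (ler_normD _ _))// normrZ (ger0_norm h0).
have := cB y; have : h * `|w| <= h * (a * b) by rewrite ler_wpM2l.
have : (1 - h * a) * `|y| <= (1 - h * a) * b by rewrite ler_wpM2l// subr_ge0.
nra.
Qed.

Lemma exp_integrator_norm_le (R : realType) (n : nat) (B : 'M[R]_n)
    (h0 a b : R) (u w : 'rV[R]_n) :
  B^T = B -> 0 < a -> 0 < h0 -> h0 * a <= 1 ->
  (forall h (v : 'rV[R]_n), 0 <= h <= h0 ->
     `|v + h *: (v *m B)| <= (1 - h * a) * `|v|) ->
  `|u| <= b -> `|w| <= a * b ->
  `|u *m mxfun (@expR R) B + w *m mxfun (@phi1 R) B| <= b.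
Proof.
move=> symB a0 h00 h0a cB ub wb.
have [P [d [Pu eqB fB]]] := mxfun_spec symB; rewrite !fB.
have dn0 k : d 0 k != 0.
  (* Row [k] of [P] is a left eigenvector for [d 0 k]. For eigenvalue zero the Euler map of step
     [h0] would fix it, against the factor [1 - h0 * a < 1]. *)
  apply/negP => /eqP dk.
  have vB : row k P *m B = 0.
    rewrite eqB /spec_mx map_mx_id// mulmxA -row_mul mulmxA mulmxV// mul1mx.
    by rewrite row_diag_mx dk scale0r mul0mx.
  have vn0 : 0 < `|row k P|.
    rewrite normr_gt0; apply/negP => /eqP v0.
    have := congr1 (mulmx^~ (invmx P)) v0.
    rewrite mul0mx -row_mul mulmxV// => /rowP/(_ k).
    by rewrite !mxE eqxx => /eqP; rewrite oner_eq0.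
  have := cB h0 (row k P); rewrite vB scaler0 addr0 lexx ltW//= => /(_ isT).
  rewrite mulrBl mul1r lerBrDl gerDr; apply/negP; rewrite -ltNge.
  by rewrite mulr_gt0// mulr_gt0.
have b0 : 0 <= b by exact: le_trans ub.
apply/(mx_norm_leP _ b0) => i j; rewrite ord1 mxE.
(* These [m.+1] steps reach time 1; a time step [tau] is meant to be absorbed in [B] and [w]. *)
pose y m := euler B m.+1%:R^-1 u w m.+1.
have cy : y m 0 j @[m --> \oo] -->
    (u *m spec_mx P d (@expR R)) 0 j + (w *m spec_mx P d (@phi1 R)) 0 j.
  rewrite /y eqB; under eq_fun do rewrite euler_spec// mxE.
  apply: cvgD; apply: cvg_mul_spec_mx => k; first exact: cvg_expR_compound.
  by apply: cvgMr; apply: cvgB; [exact: cvg_expR_compound|exact: cvg_cst].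
apply: (cvgr_to_le (cvg_norm cy)).
(* The contraction is assumed only for steps up to [h0], hence the bound for large [m] only. *)
near=> m.
have hm : m.+1%:R^-1 < h0 by near: m; exact: (cvgr_lt _ (@cvg_harmonic R)).
apply: le_trans (mx_norm_entry _ _ _) _.
have hge0 : 0 <= m.+1%:R^-1 :> R by rewrite invr_ge0.
apply: (@euler_norm_le _ _ _ _ a) => //.
  by apply: le_trans h0a; rewrite ler_wpM2r// ltW.
by move=> v; apply: cB; rewrite hge0 ltW.
Unshelve. all: by end_near.
Qed.

(** * Symmetry and contraction for the discrete operator *)

Lemma lin_mx_sym (R : realType) (m n : nat)
    (g : 'M[R]_(m, n) -> 'M[R]_(m, n)) :
  (forall i j k l, g (delta_mx i j) k l = g (delta_mx k l) i j) ->
  (lin_mx g)^T = lin_mx g.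
Proof.
move=> gsym; apply/matrixP => x y.
case/mxvec_indexP: x => i j; case/mxvec_indexP: y => k l.
by rewrite !mxE /= !vec_mx_delta !mxvecE.
Qed.

(** Exchanging the two grid points swaps forward and backward neighbours, because [ordS] and
    [ord_pred] are mutually inverse. *)
Lemma laplacian_delta_sym (R : realType) (L : R) (M : nat) (i j k l : 'I_M) :
  laplacian L (delta_mx i j) k l = laplacian L (delta_mx k l) i j.
Proof.
have S x y : (@ordS M x == y) = (ord_pred y == x).
  by rewrite [RHS]eq_sym; exact: (can2_eq (@ordSK M) (@ord_predK M)).
rewrite !mxE !S -!S ![j == _]eq_sym ![i == _]eq_sym.
by congr (_ * _); ring.
Qed.

Lemma Lkappa_linear (R : realType) (L : R) (M : nat) (eps kappa gn tau : R) :
  linear (fun v : 'M[R]_M => - tau *: Lkappa L eps kappa gn v).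
Proof. by move=> a u v; apply/matrixP => i j; rewrite !mxE; ring. Qed.

(** The new value puts weight [1 - h * a - 4 * (h * c)] on [v i j] and [h * c] on each of the four
    neighbours. The step restriction makes all weights nonnegative, and they sum to [1 - h * a]. *)
Lemma Lkappa_contraction (R : realType) (L : R) (M : nat)
    (eps kappa gn tau h : R) (v : 'M[R]_M) :
  let a := tau * (kappa * gn) in
  let c := tau * eps ^+ 2 / mesh L M ^+ 2 in
  0 <= c -> 0 <= h -> h * (a + 4 * c) <= 1 ->
  `|v + h *: (- tau *: Lkappa L eps kappa gn v)| <= (1 - h * a) * `|v|.
Proof.
move=> a c c0 h0 hac.
have hc0 : 0 <= h * c by rewrite mulr_ge0.
have ha1 : h * a + 4 * (h * c) <= 1 by lra.
apply/mx_norm_leP => [|i j]; first by rewrite mulr_ge0//; lra.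
rewrite !mxE.
have := mx_norm_entry v; set b := `|v| => vb.
rewrite [X in `|X|](_ : _ = (1 - h * a - 4 * (h * c)) * v i j + h * c *
  (v (ordS i) j + v (ord_pred i) j + v i (ordS j) + v i (ord_pred j))); last first.
  by rewrite /a /c; ring.
have vb4 : `|v (ordS i) j + v (ord_pred i) j + v i (ordS j) + v i (ord_pred j)|
    <= 4 * b.
  move: (vb (ordS i) j) (vb (ord_pred i) j) (vb i (ordS j)) (vb i (ord_pred j)).
  by rewrite !ler_norml => /andP[? ?] /andP[? ?] /andP[? ?] /andP[? ?]; lra.
apply: le_trans (ler_normD _ _) _; rewrite [`|h * c * _|]normrM (ger0_norm hc0).
rewrite [X in X + _]normrM [`|1 - _ - _|]ger0_norm; last by lra.
have := ler_wpM2l hc0 vb4; have := vb i j.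
have : 0 <= 1 - h * a - 4 * (h * c) by lra.
nra.
Qed.

(** * The bound on the stabilized nonlinearity *)

Lemma sup_norm_on_ge (R : realType) (a b : R) (g : R -> R) :
  continuous g -> {in `[a, b], forall x, `|g x| <= sup_norm_on a b g}.
Proof.
move=> cg x xab.
have ab : a <= b by move: xab; rewrite in_itv/= => /andP[/le_trans]; exact.
have [|c cab cmax] := @EVT_max R (fun x => `|g x|) a b ab.
  by apply: continuous_subspaceT => y; apply: cvg_norm; exact: cg.
apply: ub_le_sup; last by exists x.
by exists `|g c| => _ [y yab <-]; exact: cmax.
Qed.

Lemma stabilized_bound (R : realType) (beta kappa : R) (f : R -> R) :
  continuously_differentiable f -> f beta <= 0 -> 0 <= f (- beta) ->
  sup_norm_on (- beta) beta (f^`())%classic <= kappa ->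
  forall x, `|x| <= beta -> `|f x + kappa * x| <= kappa * beta.
Proof.
move=> [df cf'] fb fNb kf x; rewrite ler_norml => /andP[bx xb].
pose g := f + (kappa \*: id).
have dg y : is_derive y (1 : R) g ((f^`())%classic y + kappa).
  have := is_deriveD (derivableP (df y)) (is_deriveZ kappa (is_derive_id y (1 : R))).
  by rewrite [kappa *: _]mulr1 -derive1E.
have g_ndecr : forall y z, - beta <= y -> y <= z -> z <= beta -> g y <= g z.
  apply: ger0_derive1_ndecr => [y _|y yb|]; first by have [] := dg y.
    rewrite derive1E (@derive_val _ _ _ _ _ _ _ (dg y)).
    have yb' : y \in `[- beta, beta] by exact: subset_itv_oo_cc yb.
    have := le_trans (sup_norm_on_ge cf' yb') kf.
    by rewrite ler_norml => /andP[+ _]; lra.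
  apply: continuous_subspaceT => y; apply: differentiable_continuous.
  by apply/derivable1_diffP; have [] := dg y.
have gE y : g y = f y + kappa * y by [].
(* Compares [g x] with the endpoint values; the signs of [f] there give
   [- (kappa * beta) <= g (- beta)] and [g beta <= kappa * beta]. *)
have := g_ndecr _ _ (lexx _) bx xb; have := g_ndecr _ _ bx xb (lexx _).
rewrite !gE ler_norml => gxb gbx; apply/andP; split; lra.
Qed.

(** * One step of the scheme, and the induction *)

Lemma gsav_ei1_step_norm_le (R : realType) (L : R) (M : nat)
    (eps beta kappa tau : R) (f F sigma : R -> R) (us : 'M[R]_M * R) :
  0 < tau -> 0 < kappa -> (forall x, 0 < sigma x) ->
  (forall x, `|x| <= beta -> `|f x + kappa * x| <= kappa * beta) ->
  `|us.1| <= beta ->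
  `|(gsav_ei1_step L eps f F sigma kappa tau us).1| <= beta.
Proof.
case: us => u s /= tau0 kappa0 sigma0 fk ub.
set gn := gratio L F sigma u s.
(* Only through [gn] does [s] affect the new [u], and [gn] is positive whatever [s] is: the bound on
   [u] propagates without control of [s]. *)
have gn0 : 0 < gn by rewrite /gn /gratio divr_gt0.
set A := fun v : 'M[R]_M => _.
pose Al : {linear 'M[R]_M -> 'M[R]_M} := HB.pack A
  (GRing.isLinear.Build _ _ _ _ A (@Lkappa_linear R L M eps kappa gn tau)).
set N := Nkappa _ _ _ _ _ _ _ _.
have beta0 : 0 <= beta by exact: le_trans ub.
pose a := tau * (kappa * gn); pose c := tau * eps ^+ 2 / mesh L M ^+ 2.
have a0 : 0 < a by apply: mulr_gt0 => //; exact: mulr_gt0.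
have c0 : 0 <= c by rewrite /c divr_ge0 ?sqr_ge0// mulr_ge0 ?sqr_ge0 ?ltW.
(* The same [gn] multiplies [f] and the stabilization, so [N] is [gn] times [f + kappa * id]
   evaluated at [u]. *)
have Nb : `|tau *: mxvec N| <= a * beta.
  rewrite normrZ mxvec_norm gtr0_norm// /a -mulrA.
  apply: ler_wpM2l; first exact: ltW.
  apply/mx_norm_leP => [|i j]; first by apply: mulr_ge0 => //; exact/ltW/mulr_gt0.
  rewrite !mxE -/gn.
  have -> : gn * f (u i j) + kappa * gn * u i j = gn * (f (u i j) + kappa * u i j).
    by ring.
  rewrite normrM (gtr0_norm gn0) (mulrC kappa gn) -(mulrA gn).
  apply: ler_wpM2l; first exact: ltW.
  by apply: fk; exact: le_trans (mx_norm_entry _ _ _) ub.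
rewrite /opfun -linearZ -linearD/= -mxvec_norm vec_mxK scalemxAl.
(* [(a + 4 * c)^-1] is the largest Euler step that keeps the weight on [v i j] nonnegative. It
   restricts only the auxiliary iteration, not [tau]. *)
apply: (@exp_integrator_norm_le _ _ _ (a + 4 * c)^-1 a) => //.
- apply: lin_mx_sym => i j k l; rewrite mxE [RHS]mxE; congr (_ * _).
  rewrite mxE [RHS]mxE; congr (_ + _).
    by rewrite !mxE ![k == _]eq_sym ![l == _]eq_sym.
  rewrite mxE [RHS]mxE; congr (- _); rewrite mxE [RHS]mxE.
  by rewrite laplacian_delta_sym.
- by rewrite invr_gt0; lra.
- by rewrite mulrC ler_pdivrMr; lra.
- move=> h v /andP[h0 hh]; rewrite -[v]vec_mxK (mul_vec_lin Al) -linearZ -linearD/=.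
  rewrite !mxvec_norm; apply: Lkappa_contraction => //.
  have ac0 : 0 < a + 4 * c by lra.
  by have := ler_wpM2r (ltW ac0) hh; rewrite mulVf ?gt_eqF.
- by rewrite mxvec_norm.
Qed.

Theorem theorem3p3 (R : realType) (L : R) (M : nat) (eps beta kappa : R)
    (f F sigma : R -> R) (u_init : 'M[R]_M)
    (L_gt0 : 0 < L) (M_gt0 : (0 < M)%N) (eps_gt0 : 0 < eps)
    (f_C1 : continuously_differentiable f)
    (beta_gt0 : 0 < beta) (f_beta : f beta <= 0) (f_Nbeta : 0 <= f (- beta))
    (dF : forall x : R, is_derive x (1 : R) F (- f x))
    (kappa_gt0 : 0 < kappa)
    (sigma_C1 : continuously_differentiable sigma)
    (sigma_gt0 : forall x : R, 0 < sigma x)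
    (dsigma_ge0 : forall x : R, 0 <= (sigma^`())%classic x)
    (kappa_ge : sup_norm_on (- beta) beta (f^`())%classic <= kappa) :
  forall tau : R, 0 < tau ->
    `|u_init| <= beta ->
    forall n : nat, `|(gsav_ei1 L eps f F sigma kappa tau u_init n).1| <= beta.
Proof.
move=> tau tau_gt0 ub; elim=> [//|n IH].
rewrite /gsav_ei1 iterS; apply: gsav_ei1_step_norm_le => //.
exact: stabilized_bound.
Qed.
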